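(* Suppose $\alpha(n)$ is a log-polynomial sequence of degree $m\ge2$ with data $\{A(n),\kappa,\delta(n)\}$. Then $\alpha$ is Hermite-Jensen of degree $d$ with the same data $\{A(n),\kappa,\delta(n)\}$ for every $d$ with $1\le d\le m+1$.
   Context: Jensen polynomials: $J_\alpha^{d,n}(X)=\sum_{j=0}^d\binom{d}{j}\alpha(n+j)X^j$ and $K_\alpha^{d,n}(X)=X^dJ_\alpha^{d,n}(1/X)=\sum_{j=0}^d\binom dj\alpha(n+j)X^{d-j}$. Limits of polynomials of bounded degree are coefficientwise. $H_d$ is the (physicists') Hermite polynomial, defined by $e^{2Xt-t^2}=\sum_{d\ge0}H_d(X)t^d/d!$. Equivalently, $$H_d(X/2)=\sum_{k}\frac{d!}{(d-k)!}\binom{d-k}{k}(-1)^kX^{d-2k},\qquad i^{-d}H_d(iX/2)=\sum_k\frac{d!}{(d-k)!}\binom{d-k}{k}X^{d-2k}.$$ Log-polynomial: let $m\ge2$ be an integer and $\kappa\in\{1,-1\}$. A sequence of positive reals $\alpha(n)$ is log-polynomial of degree $m$ with data $\{A(n),\kappa,\delta(n)\}$ if there are real sequences $A(n),\delta(n),g_k(n)$ ($3\le k\le m$) such that $$\log\left(\frac{\alpha(n+j)}{\alpha(n)}\right)=A(n)j+\kappa\delta(n)^2j^2+\sum_{k=3}^m g_k(n)j^k+o(\delta(n)^{m+1})\quad(n\to\infty)$$ for $j=1,\dots,m+1$. In addition, $\delta(n)>0$, $\delta(n)\to0$ and $g_k(n)=o(\delta(n)^k)$. Hermite-Jensen: a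 sequence of positive reals $\alpha(n)$ is Hermite-Jensen of degree $d\ge1$ with data $\{A(n),\kappa,\delta(n)\}$ (where $\kappa=\pm1$ and $\delta(n)>0$) if, as $n\to\infty$, both $$\frac{\delta(n)^{-d}}{\alpha(n)}J_\alpha^{d,n}\!\left(\frac{\delta(n)X-1}{e^{A(n)}}\right)\quad\text{and}\quad\frac{(e^{A(n)}\delta(n))^{-d}}{\alpha(n)}K_\alpha^{d,n}\!\left(e^{A(n)}(\delta(n)X-1)\right)$$ converge coefficientwise to $H_d(X/2)$ if $\kappa=-1$, and to $i^{-d}H_d(iX/2)$ if $\kappa=1$. *)

(* Defs.v *)
From HB Require Import structures.
From mathcomp Require Import all_boot all_order all_algebra.
From mathcomp Require Import all_classical all_reals all_analysis.
Set Implicit Arguments. Unset Strict Implicit. Unset Printing Implicit Defensive.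
Import Order.TTheory GRing.Theory Num.Theory.
Import numFieldNormedType.Exports.
Local Open Scope classical_set_scope.
Local Open Scope ring_scope.

Section Defs.
Variable R : realType.

Definition jensenJ (alpha : nat -> R) (d n : nat) : {poly R} :=
  \sum_(j < d.+1) ('C(d, j)%:R * alpha (n + j)%N) *: 'X^j.

(* K_alpha^{d,n}(X) = X^d J(1/X) = sum_j C(d,j) alpha(n+j) X^(d-j) *)
Definition jensenK (alpha : nat -> R) (d n : nat) : {poly R} :=
  \sum_(j < d.+1) ('C(d, j)%:R * alpha (n + j)%N) *: 'X^(d - j).

(* Physicists' Hermite polynomial H_d, via its standard closed form
   H_d(X) = sum_k (-1)^k d!/(d-k)! C(d-k,k) (2X)^(d-2k)
   (coefficients of e^{2Xt-t^2} = sum H_d(X) t^d/d!). *)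
Definition hermite (d : nat) : {poly R} :=
  \sum_(k < d./2.+1)
     ((-1) ^+ k * (d ^_ k * 'C(d - k, k))%:R * 2 ^+ (d - k.*2)) *: 'X^(d - k.*2).

Definition hermite_half (d : nat) : {poly R} := hermite d \Po (2^-1 *: 'X).

(* i^{-d} H_d(iX/2) = sum_k d!/(d-k)! C(d-k,k) X^(d-2k)  (formula from the paper) *)
Definition hermite_half_i (d : nat) : {poly R} :=
  \sum_(k < d./2.+1) ((d ^_ k * 'C(d - k, k))%:R) *: 'X^(d - k.*2).

Definition poly_cvg (P : nat -> {poly R}) (Q : {poly R}) : Prop :=
  forall i : nat, (fun n => (P n)`_i) @ \oo --> Q`_i.

Definition log_polynomial (m : nat) (alpha : nat -> R)
    (A : nat -> R) (kappa : R) (delta : nat -> R) : Prop :=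
  (2 <= m)%N /\ (kappa = 1 \/ kappa = -1) /\
  (forall n, 0 < alpha n) /\
  (forall n, 0 < delta n) /\ delta @ \oo --> 0 /\
  exists g : nat -> nat -> R,
    (forall k, (3 <= k <= m)%N ->
       (fun n => g k n / delta n ^+ k) @ \oo --> 0) /\
    (forall j, (1 <= j <= m.+1)%N ->
       (fun n =>
          (ln (alpha (n + j)%N / alpha n)
           - (A n * j%:R + kappa * delta n ^+ 2 * j%:R ^+ 2
              + \sum_(3 <= k < m.+1) g k n * j%:R ^+ k))
          / delta n ^+ m.+1) @ \oo --> 0).

Definition hermite_jensen (d : nat) (alpha : nat -> R)
    (A : nat -> R) (kappa : R) (delta : nat -> R) : Prop :=
  (1 <= d)%N /\ (kappa = 1 \/ kappa = -1) /\ (forall n, 0 < delta n) /\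
  let target := if kappa == 1 then hermite_half_i d else hermite_half d in
  poly_cvg (fun n => (delta n ^- d / alpha n) *:
              (jensenJ alpha d n \Po ((expR (A n))^-1 *: (delta n *: 'X - 1))))
           target /\
  poly_cvg (fun n => ((expR (A n) * delta n) ^- d / alpha n) *:
              (jensenK alpha d n \Po (expR (A n) *: (delta n *: 'X - 1))))
           target.

End Defs.

(* Main.v *)
(* Put w_j(n) = e^{-A(n) j} alpha(n+j)/alpha(n).  Expanding (delta X - 1)^j shows
   that the coefficient of X^i in either normalised Jensen polynomial is, up to
   the sign (-1)^(d-i) for J, binom(d,i) delta^(-D) times a D-th finite difference
   of j |-> w_j, where D = d - i.  Exponentiating the hypothesis gives
   w_j = Q_n(delta j) + o(delta^(m+1)), where the polynomials Q_n converge
   coefficientwise to a truncation of exp(kappa X^2).  A D-th difference kills the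
   powers j^k with k < D and sends j^D to D!, while those with k > D contribute
   O(delta^k); hence the limit is binom(d,i) D! [X^D] exp(kappa X^2), which vanishes
   for odd D and is the Hermite coefficient for even D. *)
Require Import Defs.
From HB Require Import structures.
From mathcomp Require Import all_boot all_order all_algebra.
From mathcomp Require Import all_classical all_reals all_analysis.
From mathcomp Require Import ring zify.
Set Implicit Arguments.
Unset Strict Implicit.
Unset Printing Implicit Defensive.
Import Order.TTheory GRing.Theory Num.Theory.
Import numFieldNormedType.Exports.
Local Open Scope classical_set_scope.
Local Open Scope ring_scope.

(** * Finite differences and their values on monomials *)

Section FiniteDifference.
Variable R : comNzRingType.

(** The operator (S - 1)^D, with S the shift, expanded binomially: the Jensen coefficients arise in
    this form. *)
Definition fdiff (D : nat) (f : nat -> R) (i : nat) : R :=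
  \sum_(l < D.+1) (-1) ^+ (D - l) *+ 'C(D, l) * f (i + l)%N.

(** Pascal's rule on ['C(D.+1, l.+1)] gives (S - 1)^(D+1) = (S - 1)^D (S - 1). *)
Lemma fdiffS D f i :
  fdiff D.+1 f i = fdiff D (fun j => f j.+1 - f j) i.
Proof.
rewrite /fdiff (eq_bigr (fun l : 'I_D.+1 =>
  (-1) ^+ (D - l) *+ 'C(D, l) * f (i + l.+1)%N
  - (-1) ^+ (D - l) *+ 'C(D, l) * f (i + l)%N)); last first.
  by move=> l _; rewrite mulrBr addnS.
rewrite sumrB big_ord_recl /= [X in _ = _ - X]big_ord_recl /= !subn0 !bin0.
under eq_bigr => l _.
  rewrite /bump add1n subSS binS mulrnDr mulrDl.
  over.
rewrite big_split /= big_ord_recr /= bin_small // mulr0n mul0r addr0.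
rewrite exprS mulN1r mulNrn mulNr.
have -> : \sum_(l < D) (-1) ^+ (D - l) *+ 'C(D, l.+1) * f (i + l.+1)%N =
  - \sum_(l < D) (-1) ^+ (D - bump 0 l) *+ 'C(D, bump 0 l) * f (i + bump 0 l)%N.
  rewrite -sumrN; apply: eq_bigr => l _.
  rewrite /bump add1n -mulNr -mulNrn -(mulN1r (_ ^+ _)) -exprS.
  by rewrite subnSK.
ring.
Qed.

Lemma eq_fdiff D f g i : f =1 g -> fdiff D f i = fdiff D g i.
Proof. by move=> fg; apply: eq_bigr => l _; rewrite fg. Qed.

Lemma fdiff_sum D (I : Type) (r : seq I) (c : I -> R) (f : I -> nat -> R) i :
  fdiff D (fun j => \sum_(k <- r) c k * f k j) i =
  \sum_(k <- r) c k * fdiff D (f k) i.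
Proof.
rewrite /fdiff; under eq_bigr => l _ do rewrite mulr_sumr.
rewrite exchange_big; apply: eq_bigr => k _; rewrite mulr_sumr.
by apply: eq_bigr => l _; rewrite mulrCA.
Qed.

(** Induction on [D]: one difference turns j^k into the sum of C(k,r) j^r over r < k. Only r = D can
    survive the remaining D differences, and C(D+1,D) D! = (D+1)!. *)
Lemma fdiff_monomial D k i : (k <= D)%N ->
  fdiff D (fun j => j%:R ^+ k) i = if k == D then (D`!)%:R else 0.
Proof.
elim: D k i => [|D IH] k i.
  by rewrite leqn0 => /eqP ->; rewrite /fdiff big_ord1 /= !expr0 bin0 mulr1.
move=> kD; rewrite fdiffS.
rewrite (@eq_fdiff _ _ (fun j => \sum_(r < k) 'C(k, r)%:R * j%:R ^+ r)); last first.
  move=> j; rewrite -[j.+1]add1n natrD exprDn big_ord_recr /=.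
  rewrite subnn expr0 mul1r binn mulr1n addrK.
  by apply: eq_bigr => r _; rewrite expr1n mul1r mulr_natl.
rewrite fdiff_sum; case: (eqVneq k D.+1) => [->|kD1].
  rewrite big_ord_recr /= IH // eqxx big1 ?add0r; last first.
    by move=> r _; rewrite IH 1?ltnW // ltn_eqF ?mulr0.
  by rewrite binSn -natrM factS.
by apply: big1 => r _; rewrite IH ?ltn_eqF ?mulr0 //; have := ltn_ord r; lia.
Qed.

End FiniteDifference.

(** * A Taylor estimate, coefficientwise limits, and limits of scaled differences *)

Section Limits.
Variable R : realType.

(** Since |x| <= 1, each tail term |x|^s/s! with s > N is at most |x|^(N+1)/s!, and the 1/s! sum to
    at most e. The bound is proved on partial sums and passes to the limit. *)
Lemma expR_taylor_le (N : nat) (x : R) : `|x| <= 1 ->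
  `|expR x - (\poly_(s < N.+1) (s`!%:R)^-1).[x]| <= expR 1 * `|x| ^+ N.+1.
Proof.
move=> x1; set p := (\poly_(s < N.+1) _).
have px : p.[x] = \sum_(0 <= s < N.+1) exp_coeff x s.
  rewrite /p horner_poly big_mkord; apply: eq_bigr => s _.
  by rewrite /exp_coeff /= mulrC.
have cv : (fun K => `|series (exp_coeff x) K - p.[x]|) @ \oo --> `|expR x - p.[x]|.
  by apply: cvg_norm; apply: cvgB; [exact: is_cvg_series_exp_coeff|exact: cvg_cst].
rewrite -(cvg_lim _ cv) //; apply: limr_le; first by apply/cvg_ex; eexists; exact: cv.
near=> K.
have NK : (N.+1 <= K)%N by near: K; exact: nbhs_infty_ge.
rewrite px /series /= (big_cat_nat (leq0n _) NK) //= addrAC subrr add0r.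
apply: le_trans (ler_norm_sum _ _ _) _.
apply: (@le_trans _ _ (\sum_(N.+1 <= s < K) `|x| ^+ N.+1 * exp_coeff (1 : R) s)).
  rewrite !big_nat; apply: ler_sum => s /andP[Ns _].
  rewrite /exp_coeff /= expr1n normrM normrX normfV normr_nat.
  rewrite mul1r ler_wpM2r ?invr_ge0 ?ler0n //.
  exact: ler_wiXn2l.
rewrite -mulr_sumr mulrC ler_wpM2r ?exprn_ge0 //.
apply: (@le_trans _ _ (series (exp_coeff (1 : R)) K)).
  rewrite /series /= [leRHS](big_cat_nat (leq0n _) NK) //= lerDr sumr_ge0 // => s _.
  by rewrite exp_coeff_ge0.
apply: nondecreasing_cvgn_le; last exact: is_cvg_series_exp_coeff.
by apply: nondecreasing_series => s _ _; rewrite exp_coeff_ge0.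
Unshelve. all: by end_near.
Qed.

Lemma cvg_big_sum (I : Type) (r : seq I) (f : I -> nat -> R) (l : I -> R) :
  (forall k, f k @ \oo --> l k) ->
  (fun n => \sum_(k <- r) f k n) @ \oo --> \sum_(k <- r) l k.
Proof.
move=> fl; elim: r => [|k r IH].
  by under eq_fun do rewrite big_nil; rewrite big_nil; exact: cvg_cst.
by under eq_fun do rewrite big_cons; rewrite big_cons; exact: cvgD.
Qed.

Lemma cvg_exprn (u : nat -> R) (l : R) k :
  u @ \oo --> l -> (fun n => u n ^+ k) @ \oo --> l ^+ k.
Proof.
move=> ul; elim: k => [|k IH]; first by under eq_fun do rewrite expr0; exact: cvg_cst.
by under eq_fun do rewrite exprS; rewrite exprS; exact: cvgM.
Qed.

Lemma poly_cvgM (P Q : nat -> {poly R}) p q :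
  poly_cvg P p -> poly_cvg Q q -> poly_cvg (fun n => P n * Q n) (p * q).
Proof.
move=> Pp Qq i; under eq_fun do rewrite coefM; rewrite coefM.
by apply: cvg_big_sum => j; exact: cvgM.
Qed.

Lemma poly_cvg_cst (p : {poly R}) : poly_cvg (fun=> p) p.
Proof. by move=> i; exact: cvg_cst. Qed.

Lemma poly_cvgX (P : nat -> {poly R}) p k :
  poly_cvg P p -> poly_cvg (fun n => P n ^+ k) (p ^+ k).
Proof.
move=> Pp; elim: k => [|k IH].
  exact: poly_cvg_cst.
move=> i; under eq_fun do rewrite exprS; rewrite exprS.
exact: poly_cvgM Pp IH i.
Qed.

Lemma poly_cvg_comp (e : {poly R}) (P : nat -> {poly R}) p :
  poly_cvg P p -> poly_cvg (fun n => e \Po P n) (e \Po p).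
Proof.
move=> Pp i; under eq_fun do rewrite coef_comp_poly; rewrite coef_comp_poly.
apply: cvg_big_sum => k; apply: cvgM; first exact: cvg_cst.
exact: poly_cvgX.
Qed.


(** Split e^y - E(x) as e^x (e^(y-x) - 1) + (e^x - E(x)). The first part is O(|y - x|) = o(delta^M);
    the second is O(|x|^(M+1)), and |x|^(M+1)/delta^M = |x/delta|^M |x| tends to 0. *)
Lemma expR_poly_approx (M : nat) (delta x y : nat -> R) :
  (forall n, 0 < delta n) -> delta @ \oo --> 0 ->
  (fun n => x n / delta n) @ \oo --> 0 ->
  (fun n => (y n - x n) / delta n ^+ M) @ \oo --> 0 ->
  (fun n => (expR (y n) - (\poly_(s < M.+1) (s`!%:R)^-1).[x n]) / delta n ^+ M)
    @ \oo --> 0.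
Proof.
move=> d_gt0 d0 xd yx; set E := (\poly_(s < M.+1) _).
have dN0 n : delta n != 0 by rewrite gt_eqF.
have x0 : x @ \oo --> 0.
  rewrite -(mul0r 0) (_ : x = (fun n => x n / delta n * delta n)).
    exact: cvgM.
  by apply/funext => n; rewrite divfK.
have h0 : (fun n => y n - x n) @ \oo --> 0.
  rewrite -[0](mul0r (0 ^+ M)).
  under eq_fun => n do rewrite -(divfK (expf_neq0 M (dN0 n)) (y n - x n)).
  by apply: cvgM => //; exact: cvg_exprn.
(* Eventually |x| and |y - x| are at most 1. One factor e bounds e^x, the other comes from |e^h - 1|
   <= e |h|, the Taylor bound with N = 0. *)
pose b n := expR 1 ^+ 2 * `|(y n - x n) / delta n ^+ M|
            + expR 1 * (`|x n / delta n| ^+ M * `|x n|).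
apply/norm_cvg0P; apply: (@squeeze_cvgr _ _ _ _ (fun=> 0) b); last 2 first.
- exact: cvg_cst.
- have -> : 0 = expR 1 ^+ 2 * `|0 : R| + expR 1 * (`|0 : R| ^+ M * `|0 : R|).
    by rewrite normr0 !mulr0 addr0.
  apply: cvgD; apply: cvgM; do ?[exact: cvg_cst|exact: cvg_norm].
  apply: cvgM; last exact: cvg_norm.
  by apply: cvg_exprn; exact: cvg_norm.
near=> n; rewrite normr_ge0 /=.
have x1 : `|x n| <= 1 by near: n; move/cvgr0Pnorm_le: x0; apply.
have h1 : `|y n - x n| <= 1 by near: n; move/cvgr0Pnorm_le: h0; apply.
have -> : expR (y n) - E.[x n] =
    expR (x n) * (expR (y n - x n) - 1) + (expR (x n) - E.[x n]).
  by rewrite mulrBr -expRD mulr1 [x n + _]addrC subrK addrA subrK.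
rewrite mulrDl; apply: le_trans (ler_normD _ _) _; apply: lerD.
  rewrite !normrM !mulrA ler_wpM2r // expr2 -mulrA ler_pM //.
    by rewrite ger0_norm ?expR_ge0 // ler_expR (le_trans (ler_norm _)).
  have := expR_taylor_le 0 h1; rewrite expr1.
  by rewrite horner_poly big_ord1 /= expr0 mulr1 invr1.
have dM : 0 <= (delta n ^+ M)^-1 by rewrite invr_ge0 exprn_ge0 // ltW.
rewrite [`|_ / delta n|]normrM [`|(delta n)^-1|]gtr0_norm ?invr_gt0 //.
rewrite normrM [`|(_ ^+ M)^-1|]ger0_norm // exprMn exprVn mulrAC mulrA.
by rewrite -exprSr; apply: ler_wpM2r => //; exact: expR_taylor_le.
Unshelve. all: by end_near.
Qed.

(** The condition [i + D <= M] keeps all points of the difference where the approximation holds and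
    makes o(delta^M) negligible after division by delta^D. The uniform size bound [N] gives sums
    with a fixed number of terms, so limits are taken termwise. *)
Lemma fdiff_cvg (M N D i : nat) (delta : nat -> R) (w : nat -> nat -> R)
    (Q : nat -> {poly R}) (q : {poly R}) :
  (i + D <= M)%N -> (D < N)%N -> (forall n, size (Q n) <= N)%N ->
  (forall n, 0 < delta n) -> delta @ \oo --> 0 -> poly_cvg Q q ->
  (forall j, (j <= M)%N ->
    (fun n => (w n j - (Q n).[delta n * j%:R]) / delta n ^+ M) @ \oo --> 0) ->
  (fun n => fdiff D (w n) i / delta n ^+ D) @ \oo --> q`_D * (D`!)%:R.
Proof.
move=> iDM DN QN d_gt0 d0 Qq wQ.
have dN0 n : delta n != 0 by rewrite gt_eqF.
pose r n j := w n j - (Q n).[delta n * j%:R].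
have fE n : fdiff D (w n) i / delta n ^+ D =
    \sum_(l < D.+1) (-1) ^+ (D - l) *+ 'C(D, l) *
      (r n (i + l)%N / delta n ^+ M * delta n ^+ (M - D))
    + \sum_(k < N) (Q n)`_k * (delta n ^+ k / delta n ^+ D) *
        fdiff D (fun j => j%:R ^+ k) i.
  have -> : fdiff D (w n) i = fdiff D (r n) i
      + \sum_(k < N) ((Q n)`_k * delta n ^+ k) * fdiff D (fun j => j%:R ^+ k) i.
    rewrite -fdiff_sum /fdiff -big_split; apply: eq_bigr => l _ /=.
    rewrite -mulrDr /r (horner_coef_wide _ (QN n)).
    under [X in _ = _ * (_ + X)]eq_bigr => k _ do rewrite -mulrA -exprMn.
    by rewrite subrK.
  rewrite mulrDl /fdiff !mulr_suml; congr (_ + _); apply: eq_bigr => k _.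
    rewrite -!mulrA; congr (_ * (_ * _)).
    have /subnK {1}<- : (D <= M)%N by lia.
    by rewrite exprD invfM mulrAC mulVf ?mul1r // expf_neq0.
  by rewrite -!mulrA; congr (_ * (_ * _)); rewrite mulrC.
under eq_fun do rewrite fE.
have -> : q`_D * D`!%:R = \sum_(l < D.+1) 0
    + \sum_(k < N) (if k == D :> nat then q`_k * D`!%:R else 0).
  rewrite big1 // add0r -big_mkcond /=.
  by rewrite (big_pred1 (Ordinal DN)).
apply: cvgD; apply: cvg_big_sum => k.
  rewrite -(mulr0 ((-1) ^+ (D - k) *+ 'C(D, k))); apply: cvgMl_tmp.
  rewrite -(mul0r (0 ^+ (M - D))); apply: cvgM; last exact: cvg_exprn.
  by apply: wQ; have := ltn_ord k; lia.
(* For k < D the factor delta^(k-D) is unbounded, so it matters that the difference vanishes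
   exactly; for k > D the factor tends to 0. *)
case: (ltngtP k D) => kD.
- by under eq_fun do rewrite fdiff_monomial 1?ltnW // ltn_eqF // mulr0; exact: cvg_cst.
- rewrite -[X in _ --> X](mul0r (fdiff D (fun j => j%:R ^+ k) i)).
  apply: cvgM; last exact: cvg_cst.
  rewrite -[X in _ --> X](mulr0 q`_k); apply: cvgM; first exact: Qq.
  have -> : 0 = 0 ^+ (k - D) :> R by rewrite expr0n subn_eq0 leqNgt kD.
  have dE n : delta n ^+ k / delta n ^+ D = delta n ^+ (k - D) by rewrite expfB.
  under eq_fun do rewrite dE.
  exact: cvg_exprn.
- under eq_fun => n do rewrite kD divff ?expf_neq0 // mulr1 fdiff_monomial // eqxx.
  by rewrite kD; apply: cvgM; [exact: Qq|exact: cvg_cst].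
Qed.

End Limits.

(** * Coefficients of the normalised Jensen polynomials and of the Hermite targets *)

Section Coefficients.
Variable R : realType.

(** Both sides are the multinomial coefficient d!/(i! j! (d-i-j)!). The right-hand form lets C(d,i)
    leave the sum over j. *)
Lemma bin_mul_bin d i j : (i + j <= d)%N ->
  ('C(d, i + j) * 'C(i + j, i) = 'C(d, i) * 'C(d - i, j))%N.
Proof.
move=> ijd.
have f0 : (0 < (i + j)`! * ((d - (i + j))`! * (i`! * j`!)))%N by rewrite !muln_gt0 !fact_gt0.
apply/eqP; rewrite -(eqn_pmul2r f0); apply/eqP.
have e1 := bin_fact ijd.
have e2 := bin_fact (leq_addr j i); rewrite addKn in e2.
have id : (i <= d)%N by lia.
have e3 := bin_fact id.
have jd : (j <= d - i)%N by lia.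
have e4 := bin_fact jd; rewrite -subnDA in e4.
transitivity (('C(d, i + j) * ((i + j)`! * (d - (i + j))`!)) *
  ('C(i + j, i) * (i`! * j`!)))%N; first by ring.
transitivity (('C(d, i) * (i`! * ('C(d - i, j) * (j`! * (d - (i + j))`!)))) * (i + j)`!)%N.
  by rewrite e1 e2 e4 e3.
ring.
Qed.

(** For i > j the truncated exponent [j - i] is harmless, since the binomial coefficient is 0. *)
Lemma coef_linear_exp (a : R) j i :
  ((a *: 'X - 1) ^+ j)`_i = (-1) ^+ (j - i) * a ^+ i * 'C(j, i)%:R.
Proof.
rewrite addrC exprDn.
have -> : \sum_(r < j.+1) (- 1 : {poly R}) ^+ (j - r) * (a *: 'X) ^+ r *+ 'C(j, r)
   = \sum_(r < j.+1) ((-1) ^+ (j - r) * a ^+ r * 'C(j, r)%:R) *: 'X^r.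
  apply: eq_bigr => r _; rewrite exprZn -scalerAr.
  have -> : (- 1 : {poly R}) ^+ (j - r) = ((-1) ^+ (j - r))%:P.
    by rewrite rmorphXn /= polyCN.
  by rewrite mul_polyC -scaler_nat !scalerA; congr (_ *: _); ring.
rewrite coef_sumMXn; case: (ltnP i j.+1) => ij.
  by rewrite (big_pred1 (Ordinal ij)).
rewrite bin_small // mulr0 big1 // => r /= /eqP ri.
by have := ltn_ord r; lia.
Qed.

(** Only the terms j = i + l reach X^i, so the difference starts at [i]. Its sign (-1)^(d-i-l)
    differs from the (-1)^l of the expansion by (-1)^(d-i). For i > d both sides vanish. *)
Lemma coef_jensenJ (alpha : nat -> R) (d n i : nat) (a de c : R) :
  de != 0 ->
  ((de ^- d / c) *: (jensenJ alpha d n \Po (a *: (de *: 'X - 1))))`_i =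
  (-1) ^+ (d - i) * 'C(d, i)%:R *
    (fdiff (d - i) (fun j => alpha (n + j)%N / c * a ^+ j) i / de ^+ (d - i)).
Proof.
move=> de0; rewrite coefZ /jensenJ raddf_sum /= coef_sum.
under eq_bigr => j _.
  rewrite comp_polyZ rmorphXn /= comp_polyX coefZ exprZn coefZ coef_linear_exp.
  over.
case: (ltnP d i) => di.
  rewrite (bin_small di) mulr0 mul0r big1 ?mulr0 // => j _.
  by rewrite (@bin_small j) ; [rewrite !mulr0|have := ltn_ord j; lia].
rewrite -(big_mkord xpredT (fun j => 'C(d, j)%:R * alpha (n + j)%N *
  (a ^+ j * ((-1) ^+ (j - i) * de ^+ i * 'C(j, i)%:R)))).
rewrite (big_cat_nat (leq0n i)) ?leqW //= big_nat big1 ?add0r; last first.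
  by move=> j /andP[_ ji]; rewrite (@bin_small j) // !mulr0.
rewrite -{1}[i]add0n big_addn big_mkord subSn // /fdiff mulr_suml !mulr_sumr.
apply: eq_bigr => l _; have ld := ltn_ord l.
have E : 'C(d, l + i)%:R * 'C(l + i, i)%:R = 'C(d, i)%:R * 'C(d - i, l)%:R :> R.
  by rewrite addnC -!natrM bin_mul_bin //; lia.
have S : (-1) ^+ (d - i) * (-1) ^+ (d - i - l) = (-1) ^+ l :> R.
  rewrite -exprD -signr_odd -[RHS]signr_odd.
  have -> : (d - i + (d - i - l) = l + (d - i - l).*2)%N by lia.
  by rewrite oddD odd_double addbF.
have dE : de ^- d = de ^- (d - i) * de ^- i.
  by rewrite -invfM -exprD subnK.
rewrite addnK dE -S [(i + l)%N]addnC -mulr_natr.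
have i0 : de ^+ i != 0 by rewrite expf_neq0.
transitivity ('C(d, l + i)%:R * 'C(l + i, i)%:R * ((-1) ^+ (d - i) * (-1) ^+ (d - i - l) * de ^- (d - i) / c * alpha (n + (l + i))%N * a ^+ (l + i)) * (de ^- i * de ^+ i)).
  ring.
rewrite E mulVf //; ring.
Qed.

(** Here only j <= d - i reaches X^i, so the difference starts at 0, and (-1)^(d-j-i) is already its
    sign. The product a^(-d) a^(d-j) leaves a^(-j). *)
Lemma coef_jensenK (alpha : nat -> R) (d n i : nat) (a de c : R) :
  de != 0 -> a != 0 ->
  (((a * de) ^- d / c) *: (jensenK alpha d n \Po (a *: (de *: 'X - 1))))`_i =
  'C(d, i)%:R *
    (fdiff (d - i) (fun j => alpha (n + j)%N / c * a^-1 ^+ j) 0 / de ^+ (d - i)).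
Proof.
move=> de0 a0; rewrite coefZ /jensenK raddf_sum /= coef_sum.
under eq_bigr => j _.
  rewrite comp_polyZ rmorphXn /= comp_polyX coefZ exprZn coefZ coef_linear_exp.
  over.
case: (ltnP d i) => di.
  rewrite (bin_small di) mul0r big1 ?mulr0 // => j _.
  by rewrite (@bin_small (d - j)) ; [rewrite !mulr0|have := ltn_ord j; lia].
rewrite -(big_mkord xpredT (fun j => 'C(d, j)%:R * alpha (n + j)%N *
  (a ^+ (d - j) * ((-1) ^+ (d - j - i) * de ^+ i * 'C(d - j, i)%:R)))).
rewrite (@big_cat_nat _ _ _ (d - i).+1) ?ltnS ?leq_subr //= addrC.
rewrite big_nat big1 ?add0r; last first.
  by move=> j /andP[ji jd]; rewrite (@bin_small (d - j)); [rewrite !mulr0|lia].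
rewrite big_mkord /fdiff mulr_suml !mulr_sumr.
apply: eq_bigr => l _; have ld := ltn_ord l.
have E : 'C(d, l)%:R * 'C(d - l, i)%:R = 'C(d, i)%:R * 'C(d - i, l)%:R :> R.
  rewrite -!natrM -!bin_mul_bin; try lia.
  by rewrite [(i + l)%N]addnC -(bin_sub (leq_addr i l)) addKn.
have dE : de ^- d = de ^- (d - i) * de ^- i.
  by rewrite -invfM -exprD subnK.
have aE : a ^+ d = a ^+ (d - l) * a ^+ l by rewrite -exprD subnK //; lia.
have SE : (d - l - i = d - i - l)%N by lia.
rewrite exprMn invfM dE aE SE add0n -mulr_natr exprVn.
have i0 : de ^+ i != 0 by rewrite expf_neq0.
have l0 : a ^+ (d - l) != 0 by rewrite expf_neq0.
rewrite [(a ^+ _ * a ^+ _)^-1]invfM.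
transitivity ('C(d, l)%:R * 'C(d - l, i)%:R * ((-1) ^+ (d - i - l) * de ^- (d - i) / c * alpha (n + l)%N * a ^- l) * (de ^- i * de ^+ i) * (a ^- (d - l) * a ^+ (d - l))).
  ring.
rewrite E !mulVf //; ring.
Qed.

(* Both targets at once: kappa = -1 gives H_d(X/2), kappa = 1 gives i^{-d} H_d(iX/2). *)
Definition hermite_sum (kappa : R) (d : nat) : {poly R} :=
  \sum_(k < d./2.+1)
    (kappa ^+ k * (d ^_ k * 'C(d - k, k))%:R) *: 'X^(d - k.*2).

Lemma hermite_half_iE d : hermite_half_i R d = hermite_sum 1 d.
Proof. by apply: eq_bigr => k _; rewrite expr1n mul1r. Qed.

Lemma hermite_halfE d : hermite_half R d = hermite_sum (-1) d.
Proof.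
rewrite /hermite_half /hermite raddf_sum; apply: eq_bigr => k _ /=.
rewrite comp_polyZ rmorphXn /= comp_polyX exprZn scalerA.
by rewrite -[_ * 2^-1 ^+ _]mulrA -exprMn divff ?expr1n ?mulr1 // pnatr_eq0.
Qed.

(** Both sides equal d!/(d-2k)!. This turns the Hermite coefficient into C(d,2k) (2k)!/k!. *)
Lemma hermite_bin d k : (k.*2 <= d)%N ->
  (d ^_ k * 'C(d - k, k) * k`! = 'C(d, d - k.*2) * (k.*2)`!)%N.
Proof.
move=> kd; rewrite bin_sub // -mulnA bin_ffact bin_ffact.
have k1 : (k <= d)%N by lia.
have k2 : (k <= d - k)%N by lia.
apply/eqP; rewrite -(eqn_pmul2r (fact_gt0 (d - k.*2))) ffact_fact //; apply/eqP.
have := ffact_fact k2; rewrite -subnDA addnn -mulnA => ->.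
by rewrite ffact_fact.
Qed.

Lemma coef_exp_square (kappa : R) M D :
  ((\poly_(s < M.+1) (s`!%:R)^-1) \Po (kappa *: 'X^2))`_D =
  if ~~ odd D && (D./2 <= M)%N then kappa ^+ D./2 / D./2`!%:R else 0.
Proof.
have -> : (\poly_(s < M.+1) (s`!%:R)^-1) \Po (kappa *: 'X^2) =
  (\poly_(s < M.+1) (kappa ^+ s / s`!%:R)) \Po 'X^2.
  rewrite !poly_def !raddf_sum; apply: eq_bigr => s _ /=.
  by rewrite !comp_polyZ !rmorphXn /= !comp_polyX exprZn scalerA mulrC.
by rewrite coef_comp_poly_Xn // dvdn2 divn2 coef_poly ltnS; case: (odd D).
Qed.

Lemma coef_hermite_sum_small (kappa : R) d i :
  (d < i)%N -> (hermite_sum kappa d)`_i = 0.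
Proof.
move=> di; rewrite /hermite_sum coef_sumMXn big1 // => k /= /eqP kd.
by move: di; rewrite -kd ltnNge leq_subr.
Qed.

(** The bound [d <= M] keeps the needed coefficients inside the truncation. For d - i = 2k the claim
    is [hermite_bin] divided by k!; for odd d - i both sides are 0. *)
Lemma coef_hermite_sum kappa M d i : (d <= M)%N -> (i <= d)%N ->
  (hermite_sum kappa d)`_i =
  'C(d, i)%:R *
   (((\poly_(s < M.+1) (s`!%:R)^-1) \Po (kappa *: 'X^2))`_(d - i)
     * (d - i)`!%:R).
Proof.
move=> dM id; rewrite /hermite_sum coef_sumMXn coef_exp_square.
case: (boolP (odd (d - i))) => odi /=.
  rewrite mul0r mulr0 big1 // => k /= /eqP kd.
  move: odi; have -> : (d - i = k.*2)%N by have := ltn_ord k; lia.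
  by rewrite odd_double.
have eD := odd_double_half (d - i); rewrite (negbTE odi) add0n in eD.
set k := ((d - i)./2) in eD *.
have kd : (k < d./2.+1)%N by lia.
have kM : (k <= M)%N by lia.
rewrite kM (big_pred1 (Ordinal kd)); last first.
  move=> r /=; apply/eqP/eqP => [ri|->] /=; last by lia.
  by apply: val_inj => /=; have := ltn_ord r; lia.
rewrite -eD (_ : i = d - k.*2)%N /=; last by lia.
have k0 : k`!%:R != 0 :> R by rewrite pnatr_eq0 -lt0n fact_gt0.
have kd2 : (k.*2 <= d)%N by lia.
apply: (mulIf k0); rewrite -mulrA -natrM (hermite_bin kd2) natrM; field.
exact: k0.
Qed.

End Coefficients.

(** * Exponentiating the log-polynomial hypothesis *)

Section LogPolynomial.
Variable R : realType.

(** The factor e^(-A(n) j) removes the linear term of the logarithm. What remains is B_n(delta j) +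
    o(delta^(m+1)), where B_n tends to kappa X^2 because g_k/delta^k tends to 0. Q_n is the
    exponential series truncated at degree m + 1, composed with B_n. *)
Lemma log_polynomial_approx (m : nat) (alpha A delta : nat -> R) (kappa : R) :
  log_polynomial m alpha A kappa delta ->
  exists2 Q : nat -> {poly R},
    (forall n, size (Q n) <= (m.+1 * m).+1)%N /\
    poly_cvg Q ((\poly_(s < m.+2) (s`!%:R)^-1) \Po (kappa *: 'X^2)) &
    forall j, (j <= m.+1)%N ->
      (fun n => (alpha (n + j)%N / alpha n * (expR (A n))^-1 ^+ j
                 - (Q n).[delta n * j%:R]) / delta n ^+ m.+1) @ \oo --> 0.
Proof.
case=> m2 [_ [al_gt0 [d_gt0 [d0 [g [g0 gE]]]]]].
have dN0 n : delta n != 0 by rewrite gt_eqF.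
(* B n is the exponent as a polynomial in delta j. *)
pose b k n := if k == 2 then kappa
              else if (3 <= k)%N then g k n / delta n ^+ k else 0.
pose B n := \poly_(k < m.+1) b k n.
have bl k : (k < m.+1)%N -> b k @ \oo --> (if k == 2 then kappa else 0).
  move=> km; rewrite /b; case: eqP => _; first exact: cvg_cst.
  by case: ltnP => k3; [apply: g0; rewrite k3 -ltnS|exact: cvg_cst].
have BE n j : (B n).[delta n * j%:R] =
    kappa * delta n ^+ 2 * j%:R ^+ 2 + \sum_(3 <= k < m.+1) g k n * j%:R ^+ k.
  rewrite horner_poly -(big_mkord xpredT (fun k => b k n * (delta n * j%:R) ^+ k)).
  do 3![rewrite big_ltn; last by lia].
  rewrite /b /= !mul0r !add0r exprMn mulrA; congr (_ + _).
  rewrite !big_nat; apply: eq_bigr => k /andP[k3 _].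
  rewrite k3 ifF; last by apply/eqP; lia.
  by rewrite exprMn mulrA divfK // expf_neq0.
exists (fun n => (\poly_(s < m.+2) (s`!%:R)^-1) \Po B n).
  split=> [n|].
    apply: (leq_trans (size_comp_poly_leq _ _)); rewrite ltnS leq_mul //.
      by rewrite -subn1 leq_subLR add1n size_poly.
    by rewrite -subn1 leq_subLR add1n size_poly.
  apply: poly_cvg_comp => k.
  rewrite coefZ coefXn; under eq_fun do rewrite coef_poly.
  case: ltnP => km; last by rewrite gtn_eqF ?mulr0; [exact: cvg_cst|lia].
  have -> : kappa * (k == 2)%:R = if k == 2 then kappa else 0.
    by case: eqP; rewrite ?mulr1 ?mulr0.
  exact: bl.
move=> j jm.
have wE n : alpha (n + j)%N / alpha n * (expR (A n))^-1 ^+ j =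
    expR (ln (alpha (n + j)%N / alpha n) - A n * j%:R).
  by rewrite expRB lnK ?posrE ?divr_gt0 // [A n * _]mulrC expRM_natl exprVn.
(* [B n] has no terms of degree below 2 and convergent coefficients, so its value at delta j is
   o(delta). *)
have xd : (fun n => (B n).[delta n * j%:R] / delta n) @ \oo --> 0.
  have sum0 : \sum_(k < m.+1) (0 : R) = 0 by rewrite big1.
  rewrite -[X in _ --> X]sum0.
  under eq_fun do rewrite horner_poly mulr_suml.
  apply: cvg_big_sum => -[[|[|k]] km] /=.
  - by under eq_fun do rewrite /b /= !mul0r; exact: cvg_cst.
  - by under eq_fun do rewrite /b /= !mul0r; exact: cvg_cst.
  - have E n : b k.+2 n * (delta n * j%:R) ^+ k.+2 / delta n
        = b k.+2 n * (delta n ^+ k.+1 * j%:R ^+ k.+2).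
      by rewrite exprMn [delta n ^+ k.+2]exprS; field.
    have prod0 : (if k.+2 == 2 then kappa else 0) * (0 ^+ k.+1 * j%:R ^+ k.+2) = 0.
      by rewrite expr0n /= mul0r mulr0.
    rewrite -[X in _ --> X]prod0; under eq_fun do rewrite E.
    apply: cvgM; first exact: bl.
    by apply: cvgM; [exact: cvg_exprn|exact: cvg_cst].
under eq_fun do rewrite wE horner_comp.
apply: expR_poly_approx => //.
under eq_fun do rewrite BE -addrA -opprD addrA.
(* The hypothesis starts at j = 1; at j = 0 the error is identically 0, as ln 1 = 0. *)
case: (posnP j) => [->|j_gt0]; last by apply: gE; rewrite j_gt0.
have E n : (ln (alpha (n + 0)%N / alpha n)
    - (A n * 0%:R + kappa * delta n ^+ 2 * 0%:R ^+ 2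
       + \sum_(3 <= k < m.+1) g k n * 0%:R ^+ k)) / delta n ^+ m.+1 = 0.
  rewrite addn0 divff ?gt_eqF // ln1 !mulr0 expr0n mulr0 big_nat big1 ?addr0 ?subrr ?mul0r //.
  by move=> k /andP[k3 _]; rewrite expr0n gtn_eqF ?mulr0 //; lia.
by under eq_fun do rewrite E; exact: cvg_cst.
Qed.

End LogPolynomial.

(** * Convergence of both normalised Jensen polynomials *)

Theorem theorem1p6 (R : realType) (alpha A delta : nat -> R) (kappa : R) (m : nat) :
  log_polynomial m alpha A kappa delta ->
  forall d : nat, (1 <= d <= m.+1)%N ->
    hermite_jensen d alpha A kappa delta.
Proof.
move=> lp d /andP[d1 dm].
have [m2 [kE [_ [d_gt0 [d0 _]]]]] := lp.
have [Q [QN Qq] wQ] := log_polynomial_approx lp.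
split=> //; split=> //; split=> // target.
have -> : target = hermite_sum kappa d.
  rewrite /target; case: kE => ->; first by rewrite eqxx hermite_half_iE.
  by rewrite lt_eqF ?hermite_halfE ?gtrN.
have dN0 n : delta n != 0 by rewrite gt_eqF.
have eN0 n : expR (A n) != 0 by rewrite gt_eqF ?expR_gt0.
set q := _ \Po _ in Qq.
(* The start s = i serves J and s = 0 serves K; either way s + (d - i) <= d <= m + 1. *)
have lim i s : (i <= d)%N -> (s <= i)%N ->
    (fun n => fdiff (d - i)
       (fun j => alpha (n + j)%N / alpha n * (expR (A n))^-1 ^+ j) s
       / delta n ^+ (d - i)) @ \oo --> q`_(d - i) * (d - i)`!%:R.
  move=> id si.
  (* This [N] bounds the sizes of all [Q n] and exceeds d - i, because d - i <= m + 1 <= (m + 1)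
     m. *)
  apply: (fdiff_cvg (M := m.+1) (N := (m.+1 * m).+2) (Q := Q)) => //.
  - by lia.
  - have : (m.+1 <= m.+1 * m)%N by rewrite leq_pmulr // ltnW.
    by lia.
  - by move=> n; apply: leq_trans (QN n) _.
split=> i.
- under eq_fun do rewrite coef_jensenJ //.
  case: (leqP i d) => id; last first.
    under eq_fun do rewrite bin_small // mulr0 mul0r.
    by rewrite coef_hermite_sum_small //; exact: cvg_cst.
  (* The sign is harmless: the limit is zero when d - i is odd. *)
  have S : (-1) ^+ (d - i) * (q`_(d - i) * (d - i)`!%:R) = q`_(d - i) * (d - i)`!%:R.
    rewrite -signr_odd; case: (boolP (odd (d - i))) => od; last by rewrite mul1r.
    by rewrite expr1 coef_exp_square ?od // !mul0r mulr0.
  rewrite (coef_hermite_sum kappa dm id) -S mulrCA mulrA.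
  by apply: cvgMl_tmp; exact: lim.
- under eq_fun do rewrite coef_jensenK //.
  case: (leqP i d) => id; last first.
    under eq_fun do rewrite bin_small // mul0r.
    by rewrite coef_hermite_sum_small //; exact: cvg_cst.
  rewrite (coef_hermite_sum kappa dm id).
  by apply: cvgMl_tmp; exact: lim.
Qed.
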